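(* Fix integers $K>1$, $M>1$, a cost $C\ge 0$, and $\delta\in(0,1)$. For every problem instance $\boldsymbol{\mu}=[\mu_{k,m}]\in\mathbb{R}^{K\times M}$ having a unique local best arm $k_m^*$ at every client $m$ and a unique global best arm $k^*$, the algorithm FedElim (run with confidence parameter $\delta$) terminates with outputs $(\hat k_1^*,\dots,\hat k_M^*,\hat k^* )$ satisfying $$P_{\boldsymbol{\mu}}\big((\hat k_1^*,\dots,\hat k_M^*,\hat k^* )=(k_1^*,\dots,k_M^*,k^* )\big)\ge 1-\delta,$$ i.e. FedElim is $\delta$-PAC.
   Context: Setting: there are $M$ clients and a server; each client $m\in[M]$ has $K$ arms indexed by $[K]=\{1,\dots,K\}$. For each pair $(k,m)$, arm $k$ of client $m$ produces rewards $X_{k,m}(1),X_{k,m}(2),\dots$ that are i.i.d. Gaussian with unknown mean $\mu_{k,m}$ and variance $1$, independent across pairs. The $i$-th pull of arm $k$ at client $m$ reveals $X_{k,m}(i)$. Write $\hat\mu_{k,m}(n)=\frac1n\sum_{i=1}^n X_{k,m}(i)$ and $\hat\mu_k(n)=\frac1M\sum_{m=1}^M\hat\mu_{k,m}(n)$. Local best arm: $k_m^*=\arg\max_k\mu_{k,m}$; global mean $\mu_k=\frac1M\sum_m\mu_{k,m}$ and global best arm $k^*=\arg\max_k\mu_k$ (both assumed unique). Confidence parameters: $\alpha_{\mathrm l}(n)=\sqrt{2\ln(8KMn^2/\delta)/n}$ and $\alpha_{\mathrm g}(n)=\sqrt{2\ln(8Kn^2/\delta)/(Mn)}$. Algorithm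 FedElim (and its variant FedElim0). Initialize $\mathcal S_{\mathrm l,m}=[K]$ for every $m$ and $\mathcal S_{\mathrm g}=[K]$. For $n=1,2,\dots$: (i) for each client $m$: let $\mathcal S_m=\mathcal S_{\mathrm l,m}\cup\mathcal S_{\mathrm g}$; if $|\mathcal S_m|>1$, pull each arm in $\mathcal S_m$ once (so every active arm has been pulled $n$ times and its empirical mean is $\hat\mu_{k,m}(n)$). If $|\mathcal S_{\mathrm l,m}|>1$, remove from $\mathcal S_{\mathrm l,m}$ every $k$ with $\max_{j\in\mathcal S_{\mathrm l,m}}\hat\mu_{j,m}(n)-\hat\mu_{k,m}(n)\ge 2\alpha_{\mathrm l}(n)$. If then $|\mathcal S_{\mathrm l,m}|=1$, output its element as $\hat k_m^*$ and set $\mathcal S_{\mathrm l,m}=\emptyset$. (ii) Communication: if $|\mathcal S_{\mathrm g}|>1$ and $n$ is a communication time step — for FedElim this means $n=2^t$ for some integer $t\ge0$; for FedElim0 every $n$ is a communication time step — then each client $m$ sends the scalars $\hat\mu_{k,m}(n)$, $k\in\mathcal S_{\mathrm g}$, to the server, each scalar sent costing $C$; the server removes from $\mathcal S_{\mathrm g}$ every $k$ with $\max_{j\in\mathcal S_{\mathrm g}}\hat\mu_j(n)-\hat\mu_k(n)\ge 2\alpha_{\mathrm g}(n)$. If $|\mathcal S_{\mathrm g}|=1$, output its element as $\hat k^*$ and set $\mathcal S_{\mathrm g}=\emptyset$. (iii) Terminate once $\mathcal S_{\mathrm l,m}\cup\mathcal S_{\mathrm g}=\emptyset$ for all $m$.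 An algorithm is $\delta$-PAC if for every such instance $\boldsymbol\mu$ it outputs the correct vector $(k_1^*,\dots,k_M^*,k^* )$ with probability at least $1-\delta$. *)

(* Defs.v *)
From HB Require Import structures.
From mathcomp Require Import all_boot all_order all_algebra.
From mathcomp Require Import all_classical all_reals all_analysis.
Set Implicit Arguments. Unset Strict Implicit. Unset Printing Implicit Defensive.
Import Order.TTheory GRing.Theory Num.Theory.
Local Open Scope classical_set_scope.
Local Open Scope ring_scope.

Definition mutually_independent {d} {T : measurableType d} {R : realType}
  (P : probability T R) (I : eqType) (X : I -> T -> R) : Prop :=
  forall (s : seq I) (B : I -> set R),
    uniq s -> (forall i, measurable (B i)) ->
    P (\bigcap_(i in [set j | j \in s]) (X i @^-1` B i)) =
    (\prod_(i <- s) P (X i @^-1` B i))%E.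

Definition gaussian_unit_var {d} {T : measurableType d} {R : realType}
  (P : probability T R) (m : R) (Y : T -> R) : Prop :=
  measurable_fun setT Y /\
  forall B : set R, measurable B -> P (Y @^-1` B) = normal_prob m 1 B.

(* A reward realization x k m i is X_{k,m}(i+1), i.e. the reward revealed by
   the (i+1)-th pull of arm k at client m (0-based index i). *)

Section FedElim.
Variables (R : realType) (K M : nat) (delta : R).
Variable x : 'I_K -> 'I_M -> nat -> R.

Definition muhat_loc (k : 'I_K) (m : 'I_M) (n : nat) : R :=
  (\sum_(i < n) x k m i) / n%:R.

Definition muhat_glob (k : 'I_K) (n : nat) : R :=
  (\sum_(m < M) muhat_loc k m n) / M%:R.

Definition alpha_l (n : nat) : R :=
  Num.sqrt (2 * ln (8 * K%:R * M%:R * n%:R ^+ 2 / delta) / n%:R).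

Definition alpha_g (n : nat) : R :=
  Num.sqrt (2 * ln (8 * K%:R * n%:R ^+ 2 / delta) / (M%:R * n%:R)).

Definition eliminate (S : {set 'I_K}) (f : 'I_K -> R) (a : R) : {set 'I_K} :=
  [set k in S | ~~ [exists j in S, 2 * a <= f j - f k]].

Record state := State {
  Sl : 'I_M -> {set 'I_K};
  Sg : {set 'I_K};
  out_l : 'I_M -> option 'I_K;      (* outputs \hat k_m^* (None = not yet) *)
  out_g : option 'I_K }.

Definition init_state : state :=
  State (fun _ => finset.setT) finset.setT (fun _ => None) None.

Definition comm_step (n : nat) : bool := [exists t : 'I_n.+1, n == (2 ^ t)%N].

Definition local_update (n : nat) (m : 'I_M) (S : {set 'I_K}) (o : option 'I_K)
  : {set 'I_K} * option 'I_K :=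
  if (1 < #|S|)%N then
    let S' := eliminate S (fun k => muhat_loc k m n) (alpha_l n) in
    if #|S'| == 1%N then (finset.set0, [pick k in S']) else (S', o)
  else (S, o).

Definition global_update (n : nat) (S : {set 'I_K}) (o : option 'I_K)
  : {set 'I_K} * option 'I_K :=
  if (1 < #|S|)%N && comm_step n then
    let S' := eliminate S (fun k => muhat_glob k n) (alpha_g n) in
    if #|S'| == 1%N then (finset.set0, [pick k in S']) else (S', o)
  else (S, o).

Definition round (n : nat) (s : state) : state :=
  let loc := fun m => local_update n m (Sl s m) (out_l s m) in
  let glo := global_update n (Sg s) (out_g s) in
  State (fun m => (loc m).1) glo.1 (fun m => (loc m).2) glo.2.

Fixpoint state_after (N : nat) : state :=
  match N with
  | 0 => init_state
  | N'.+1 => round N'.+1 (state_after N')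
  end.

Definition terminated (s : state) : bool :=
  [forall m, Sl s m :|: Sg s == finset.set0].

End FedElim.

Definition fedelim_correct (R : realType) (K M : nat) (delta : R)
  (x : 'I_K -> 'I_M -> nat -> R) (kl : 'I_M -> 'I_K) (kg : 'I_K) : Prop :=
  exists N, let s := state_after delta x N in
    terminated s /\ (forall m, out_l s m = Some (kl m)) /\ out_g s = Some kg.

(* Main.v *)
(** With probability at least [1 - delta], every empirical mean that can ever be
    compared stays within its confidence radius.  By Chernoff's bound for sums of
    independent Gaussians, the [n]-th local means fail with total probability at
    most [delta / (4 n^2)], and so do the [n]-th global means, and
    [\sum_(n >= 1) 1 / n^2 <= 2].  On that event no best arm is ever eliminated,
    and since the radii tend to [0] and communication times are unbounded, every
    other arm eventually is.

    As a measure is unspecified on non-measurable sets, the success event must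
    also be shown measurable: the state of the algorithm after [N] rounds takes
    finitely many values and is a measurable function of the rewards. *)

Require Import Defs.
From HB Require Import structures.
From mathcomp Require Import all_boot all_order all_algebra.
From mathcomp Require Import ring lra.
From mathcomp Require Import all_classical all_reals all_analysis.
From mathcomp Require Import measurable_realfun.
Set Implicit Arguments. Unset Strict Implicit. Unset Printing Implicit Defensive.
Import Order.TTheory GRing.Theory Num.Theory.
Import numFieldNormedType.Exports.
Local Open Scope classical_set_scope.
Local Open Scope ring_scope.

(** * Integrals of functions of a random variable against a nonnegative weight *)

Section weighted_integral.
Local Open Scope ereal_scope.
Context (d d' : measure_display) (T : measurableType d) (U : measurableType d').
Context (R : realType) (P : {measure set T -> \bar R}).
Context (nu : {measure set U -> \bar R}).
Variables (G : T -> R) (X : T -> U) (c : R).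
Hypotheses (mG : measurable_fun setT G) (G0 : forall x, (0 <= G x)%R).
Hypothesis mX : measurable_fun setT X.
Hypothesis GXE : forall B, measurable B ->
  \int[P]_x (G x * \1_B (X x))%:E = c%:E * nu B.

Import HBNNSimple.

Let integral_weighted_nnsfun (h : {nnsfun U >-> R}) :
  \int[P]_x (G x * h (X x))%:E = c%:E * \int[nu]_u (h u)%:E.
Proof.
have mb y : measurable (h @^-1` [set y]) by exact: measurable_sfunP.
transitivity (\int[P]_x
    \sum_(y \in range h) (y * (G x * \1_(h @^-1` [set y]) (X x)))%:E).
  apply: eq_integral => x _; rewrite fimfunE fsumEFin//; congr EFin.
  by rewrite mulr_fsumr; apply: eq_fsbigr => y _; rewrite mulrCA.
rewrite ge0_integral_fsum//; last 2 first.
- move=> y; apply/measurable_EFinP; apply: measurable_funM => //.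
  apply: measurable_funM => //.
  by apply: measurableT_comp => //; exact: measurable_indic.
- move=> y x _; rewrite lee_fin.
  (* Nonnegativity is asked for every real [y]; a negative one has empty preimage under [h], so its
     term vanishes. *)
  have [y0|y0] := leP 0%R y; first by rewrite !mulr_ge0.
  by rewrite (preimage_nnfun0 _ y0) indic0 !mulr0.
rewrite integralT_nnsfun sintegralE ge0_mule_fsumr; last first.
  move=> y; have [y0|y0] := leP 0%R y; first by rewrite mule_ge0.
  by rewrite (preimage_nnfun0 _ y0) measure0 mule0.
apply: eq_fsbigr => y /set_mem[u _ <-{y}].
under eq_integral do rewrite EFinM.
rewrite ge0_integralZl_EFin//; last 2 first.
- by move=> x _; rewrite lee_fin mulr_ge0.
- apply/measurable_EFinP; apply: measurable_funM => //.
  by apply: measurableT_comp => //; exact: measurable_indic.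
by rewrite GXE// muleCA.
Qed.

(** The identity [GXE] on indicators passes to simple functions by linearity and to [f] by monotone
    convergence. It is used with three weights: a product of other random factors (independence), a
    density, and the constant 1 (law of a random variable). *)
Lemma ge0_integral_weighted (f : U -> R) :
  measurable_fun setT f -> (forall u, (0 <= f u)%R) ->
  \int[P]_x (G x * f (X x))%:E = c%:E * \int[nu]_u (f u)%:E.
Proof.
move=> mf f0; have mEf : measurable_fun setT (EFin \o f) by exact/measurable_EFinP.
pose h := nnsfun_approx measurableT mEf.
have hndE u : {homo (fun n => (h n u)%:E) : n m / (n <= m)%N >-> n <= m}.
  by move=> n m nm; rewrite lee_fin; exact/lefP/nd_nnsfun_approx.
have hf u : (fun n => (h n u)%:E) @ \oo --> (f u)%:E.
  by apply: (@cvg_nnsfun_approx _ _ _ _ measurableT _ mEf) => // ? _; rewrite lee_fin.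
have -> : \int[nu]_u (f u)%:E = limn (fun n => \int[nu]_u (h n u)%:E).
  rewrite -monotone_convergence//=.
  - by apply: eq_integral => u _; apply/esym/cvg_lim.
  - by move=> n; exact/measurable_EFinP.
  - by move=> n u _; rewrite lee_fin.
have -> : \int[P]_x (G x * f (X x))%:E =
    limn (fun n => \int[P]_x (G x * h n (X x))%:E).
  rewrite -monotone_convergence//=.
  - apply: eq_integral => x _; apply/esym/cvg_lim => //.
    rewrite EFinM; under eq_fun do rewrite EFinM.
    by apply: cvgeZl.
  - move=> n; apply/measurable_EFinP; apply: measurable_funM => //.
    by apply: measurableT_comp.
  - by move=> n x _; rewrite lee_fin mulr_ge0.
  - move=> x _ n m nm; rewrite lee_fin ler_wpM2l//.
    by have := hndE (X x) _ _ nm; rewrite lee_fin.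
under eq_fun do rewrite integral_weighted_nnsfun.
rewrite limeMl//; apply: ereal_nondecreasing_is_cvgn => n m nm.
apply: ge0_le_integral => //.
- by move=> u _; rewrite lee_fin.
- exact/measurable_EFinP.
- exact/measurable_EFinP.
- by move=> u _; exact: hndE.
Qed.
End weighted_integral.

(** * Expectation of a product of functions of independent variables *)

Section independence.
Local Open Scope ereal_scope.
Context (d : measure_display) (T : measurableType d) (R : realType).
Context (P : probability T R) (I : eqType).
Variables (X : I -> T -> R) (f : I -> R -> R) (e : I -> R).
Hypothesis indX : mutually_independent P X.
Hypothesis mX : forall i, measurable_fun setT (X i).
Hypotheses (mf : forall i, measurable_fun setT (f i)) (f0 : forall i x, (0 <= f i x)%R).
Hypothesis fE : forall i, \int[P]_w (f i (X i w))%:E = (e i)%:E.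

(* Turning the indicators into general functions one index at a time only uses
   uniqueness of one-dimensional laws, so no joint law is ever formed. *)
Let integral_prod_indic (s1 s2 : seq I) (B : I -> set R) :
  uniq (s1 ++ s2) -> (forall i, measurable (B i)) ->
  \int[P]_w ((\prod_(i <- s1) f i (X i w)) *
             (\prod_(i <- s2) \1_(B i) (X i w)))%:E =
  (\prod_(i <- s1) e i)%:E * \prod_(i <- s2) P (X i @^-1` B i).
Proof.
have mXB (s : seq I) B' : (forall i, measurable (B' i)) ->
    measurable (\bigcap_(i in [set j | j \in s]) (X i @^-1` B' i)).
  move=> mB'; apply: fin_bigcap_measurable => [|i _]; first exact: finite_seq.
  by rewrite -[_ @^-1` _]setTI; exact: mX.
elim: s1 s2 B => [|i s1 IH] s2 B /=.
  (* With no function left, the product of indicators is the indicator of an intersection, and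
     independence applies directly. *)
  move=> us mB; rewrite -indX// big_nil mul1e.
  rewrite -[in RHS](setIT (\bigcap_(i in _) _)) -integral_indic//; last exact: mXB.
  apply: eq_integral => w _; rewrite big_nil mul1r; congr EFin.
  rewrite indicE; have [|] := boolP (_ \in _).
    move=> /set_mem h; rewrite (@big1_seq _ _ _ _ s2)// => i si.
    by rewrite indicE mem_set//; exact: h.
  move=> /negP h; apply/eqP; rewrite prodf_seq_eq0.
  apply: contrapT => /negP /hasPn h'; apply: h; apply/mem_set => i /= si.
  have /= := h' i si; rewrite indicE.
  by have [/set_mem|] := boolP (X i w \in B i); rewrite ?eqxx.
move=> /andP[]; rewrite mem_cat negb_or => /andP[is1 is2] us mB.
have us2 : uniq s2 by move: us; rewrite cat_uniq => /and3P[].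
pose G w := ((\prod_(j <- s1) f j (X j w)) * (\prod_(j <- s2) \1_(B j) (X j w)))%R.
have mG : measurable_fun setT G.
  apply: measurable_funM; apply: measurable_prod => j _.
    exact: measurableT_comp.
  by apply: measurableT_comp => //; exact: measurable_indic.
have G0 w : (0 <= G w)%R by rewrite mulr_ge0// prodr_ge0.
(* The weighted integral lemma takes a real constant; the product is finite, so [fine] loses
   nothing. *)
pose c := fine ((\prod_(j <- s1) e j)%:E * \prod_(j <- s2) P (X j @^-1` B j)).
have fin2 : \prod_(j <- s2) P (X j @^-1` B j) \is a fin_num.
  by rewrite -indX//; apply: fin_num_measure; exact: mXB.
have cE : c%:E = (\prod_(j <- s1) e j)%:E * \prod_(j <- s2) P (X j @^-1` B j).
  by rewrite /c fineK// fin_numM.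
transitivity (\int[P]_w (G w * f i (X i w))%:E).
  by apply: eq_integral => w _; rewrite big_cons /G; congr EFin; ring.
rewrite (@ge0_integral_weighted _ _ _ _ _ P (pushforward P (X i)) G (X i) c)//.
- rewrite ge0_integral_pushforward//=.
  + by rewrite fE cE big_cons EFinM muleC muleA.
  + exact/measurable_EFinP.
  + by move=> y _; rewrite lee_fin.
(* [GXE] for [A] is the induction hypothesis with [i] moved to the indicator list and assigned the
   set [A]; since [i] is not in [s2], the other sets are unchanged. *)
- move=> A mA; pose B' j := if j == i then A else B j.
  have mB' j : measurable (B' j) by rewrite /B'; case: ifP.
  have us' : uniq (s1 ++ i :: s2).
    by rewrite uniq_catC /= mem_cat negb_or is1 is2 uniq_catC us.
  have B's2 : {in s2, B' =1 B}.
    by move=> j js2; rewrite /B'; case: eqP => // ji; rewrite -ji js2 in is2.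
  have B'i : B' i = A by rewrite /B' eqxx.
  have := IH _ _ us' mB'; rewrite big_cons B'i.
  rewrite (eq_big_seq (fun j => P (X j @^-1` B j))); last first.
    by move=> j js2; rewrite B's2.
  rewrite cE muleCA muleC => <-; apply: eq_integral => w _.
  rewrite big_cons B'i /G -mulrA; congr (_ * _)%:E; rewrite mulrC; congr (_ * _)%R.
  by apply: eq_big_seq => j js2; rewrite B's2.
Qed.

Lemma independent_integral_prod (s : seq I) : uniq s ->
  \int[P]_w (\prod_(i <- s) f i (X i w))%:E = (\prod_(i <- s) e i)%:E.
Proof.
move=> us; have := @integral_prod_indic s [::] (fun=> setT).
rewrite cats0 big_nil mule1 => <-//.
by apply: eq_integral => w _; rewrite big_nil mulr1.
Qed.
End independence.

(** * Chernoff bounds for sums and means of independent Gaussians *)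

Section gaussian_tail.
Local Open Scope ereal_scope.
Context (R : realType).

(** Completing the square: the density of mean [m] tilted by [expR (t * (x - m))] is
    [expR (t ^+ 2 / 2)] times the density of mean [m + t], whose integral is 1. *)
Lemma integral_normal_prob_expR (m t : R) :
  \int[normal_prob m 1]_x (expR (t * (x - m)))%:E = (expR (t ^+ 2 / 2))%:E.
Proof.
have me : measurable_fun setT (fun x : R => expR (t * (x - m))).
  apply: measurableT_comp => //; apply: measurable_funM => //.
  exact: measurable_funB.
have := @ge0_integral_weighted _ _ _ _ R lebesgue_measure (normal_prob m 1)
  (normal_pdf m 1) id 1 (measurable_normal_pdf m 1) (normal_pdf_ge0 m 1)
  (@measurable_id _ _ setT) _ _ me (fun x => expR_ge0 _).
rewrite mul1e => <-; last first.
  move=> B mB; rewrite mul1e /normal_prob [RHS]integral_mkcond.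
  apply: eq_integral => x _; rewrite patchE indicE.
  by case: ifPn => _; rewrite ?mulr1 ?mulr0.
transitivity (\int[lebesgue_measure]_x ((expR (t ^+ 2 / 2))%:E * (normal_pdf (m + t) 1 x)%:E)).
  apply: eq_integral => x _; rewrite -EFinM !normal_pdfE//; congr EFin.
  rewrite /normal_fun -mulrA -expRD mulrCA -expRD; congr (_ * expR _)%R.
  by rewrite expr1n; field.
rewrite ge0_integralZl_EFin//.
- by rewrite integral_normal_pdf mule1.
- by move=> x _; rewrite lee_fin normal_pdf_ge0.
- by apply/measurable_EFinP; exact: measurable_normal_pdf.
Qed.

Context (d : measure_display) (T : measurableType d) (P : probability T R).

Lemma gaussian_unit_var_mgf (m t : R) (Y : T -> R) : gaussian_unit_var P m Y ->
  \int[P]_w (expR (t * (Y w - m)))%:E = (expR (t ^+ 2 / 2))%:E.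
Proof.
move=> [mY YE]; rewrite -(integral_normal_prob_expR m).
have me : measurable_fun setT (fun x : R => expR (t * (x - m))).
  apply: measurableT_comp => //; apply: measurable_funM => //.
  exact: measurable_funB.
have := @ge0_integral_weighted _ _ _ _ R P (normal_prob m 1) (cst 1%R) Y 1
  (measurable_cst _) (fun=> ler01) mY _ _ me (fun x => expR_ge0 _).
rewrite mul1e => <-; first by apply: eq_integral => w _; rewrite mul1r.
move=> B mB; rewrite mul1e; transitivity (P (Y @^-1` B)); last exact: YE.
rewrite -[Y @^-1` B]setIT -integral_indic//.
  by apply: eq_integral => w _; rewrite mul1r.
by rewrite -[_ @^-1` _]setTI; exact: mY.
Qed.

Context (I : eqType) (X : I -> T -> R) (mu : I -> R).
Hypothesis indX : mutually_independent P X.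
Hypothesis lawX : forall i, gaussian_unit_var P (mu i) (X i).

Let S (s : seq I) w : R := (\sum_(i <- s) (X i w - mu i))%R.

Lemma measurable_centered_sum (s : seq I) : measurable_fun setT (S s).
Proof.
apply: measurable_sum => i; apply: measurable_funB => //.
by have [] := lawX i.
Qed.

(** Chernoff's method: with [n] the size of [s], the exponent [t ^+ 2 / 2 * n - t * a] is least at
    [t = a / n]. The sign [u] handles both tails at once, as only [u ^+ 2] enters the moment
    generating function. *)
Let gaussian_sum_one_sided_tail (s : seq I) (u a : R) :
  uniq s -> (0 < size s)%N -> (0 <= a)%R -> (u ^+ 2 = 1)%R ->
  P [set w | (a <= u * S s w)%R] <= (expR (- (a ^+ 2 / (2 * (size s)%:R))))%:E.
Proof.
move=> us s0 a0 u1.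
have s0' : ((size s)%:R != 0 :> R)%R by rewrite pnatr_eq0 -lt0n.
pose t := (a / (size s)%:R)%R.
have t0 : (0 <= t)%R by rewrite divr_ge0.
pose Z w := expR (t * (u * S s w)).
have mS := measurable_centered_sum s.
have mZ : measurable_fun setT Z.
  apply: measurableT_comp => //; apply: measurable_funM => //.
  exact: measurable_funM.
have EZ : \int[P]_w (Z w)%:E = (expR (t ^+ 2 / 2 * (size s)%:R))%:E.
  transitivity (\int[P]_w (\prod_(i <- s) expR (t * u * (X i w - mu i)))%:E).
    by apply: eq_integral => w _; rewrite /Z /S mulrA mulr_sumr expR_sum.
  rewrite (@independent_integral_prod _ _ _ P I X
      (fun i x => expR (t * u * (x - mu i))) (fun=> expR (t ^+ 2 / 2)))//.
  - by rewrite -expR_sum big_const_seq count_predT iter_addr_0 mulr_natr.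
  - by move=> i; have [] := lawX i.
  - move=> i; apply: measurableT_comp => //; apply: measurable_funM => //.
    exact: measurable_funB.
  - by move=> i; rewrite (gaussian_unit_var_mgf _ (lawX i)) exprMn u1 mulr1.
have mA : measurable [set w | (a <= u * S s w)%R].
  rewrite -[X in measurable X]setTI.
  by apply: measurable_fun_le => //; exact: measurable_funM.
(* Markov's inequality: [Z] is at least [expR (t * a)] on the event. *)
have : (expR (t * a))%:E * P [set w | (a <= u * S s w)%R] <= \int[P]_w (Z w)%:E.
  rewrite -[in X in X <= _](setIT [set w | _]) -integral_indic//.
  rewrite -ge0_integralZl_EFin//; last first.
    by apply/measurable_EFinP; exact: measurable_indic.
  apply: ge0_le_integral => //.
  - under eq_fun do rewrite -EFinM.
    by apply/measurable_EFinP; apply: measurable_funM.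
  - exact/measurable_EFinP.
  - move=> w _; rewrite -EFinM lee_fin indicE; have [|_] := boolP (_ \in _).
      by move=> /set_mem /= h; rewrite mulr1 ler_expR ler_wpM2l.
    by rewrite mulr0 expR_ge0.
rewrite EZ -(fineK (fin_num_measure P _ mA)) -EFinM !lee_fin.
rewrite -ler_pdivlMl ?expR_gt0// -expRN -expRD.
move=> /le_trans; apply; rewrite ler_expR /t le_eqVlt; apply/orP; left.
by apply/eqP; field.
Qed.

Lemma gaussian_sum_tail (s : seq I) (a : R) :
  uniq s -> (0 < size s)%N -> (0 <= a)%R ->
  P [set w | (a <= `|\sum_(i <- s) (X i w - mu i)|)%R] <=
  (2 * expR (- (a ^+ 2 / (2 * (size s)%:R))))%:E.
Proof.
move=> us s0 a0.
have mS := measurable_centered_sum s.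
have mA u : measurable [set w | (a <= u * S s w)%R].
  rewrite -[X in measurable X]setTI.
  by apply: measurable_fun_le => //; exact: measurable_funM.
apply: (@le_trans _ _ (P ([set w | (a <= 1 * S s w)%R] `|` [set w | (a <= -1 * S s w)%R]))).
  apply: le_measure; rewrite ?inE//.
  - rewrite -[X in measurable X]setTI.
    by apply: measurable_fun_le => //; exact: measurableT_comp.
  - exact: measurableU.
  - by move=> w /=; rewrite ler_normr mul1r mulN1r => /orP.
apply: (le_trans (measureU2 _ _ _)) => //.
rewrite mulr2n mulrDl mul1r EFinD leeD// gaussian_sum_one_sided_tail//.
  by rewrite expr1n.
by rewrite sqrrN expr1n.
Qed.

(** The radius is the one for which the Chernoff exponent equals [- ln c]; [1 <= c] keeps the
    argument of the square root nonnegative. *)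
Lemma gaussian_mean_tail (s : seq I) (c : R) :
  uniq s -> (0 < size s)%N -> (1 <= c)%R ->
  P [set w | (Num.sqrt (2 * ln c / (size s)%:R) <=
    `|(\sum_(i <- s) X i w) / (size s)%:R - (\sum_(i <- s) mu i) / (size s)%:R|)%R]
  <= (2 / c)%:E.
Proof.
move=> us s0 c1; have n0 : (0 < (size s)%:R :> R)%R by rewrite ltr0n.
have c0 : (0 < c)%R by lra.
have l0 : (0 <= 2 * ln c / (size s)%:R)%R.
  by rewrite divr_ge0 ?(ltW n0)// mulr_ge0// ln_ge0.
set a := Num.sqrt _.
have := @gaussian_sum_tail s (a * (size s)%:R) us s0.
rewrite mulr_ge0 ?sqrtr_ge0 ?(ltW n0)// => /(_ isT).
rewrite exprMn sqr_sqrtr// [X in expR (- X)](_ : _ = ln c); last by field; lra.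
rewrite expRN lnK ?posrE//; apply: le_trans; rewrite le_eqVlt; apply/orP; left.
apply/eqP; congr (P _); apply/funext => w /=; apply/propext.
rewrite -mulrBl -sumrB normrM (gtr0_norm (x := _^-1)) ?invr_gt0//.
by rewrite ler_pdivlMr.
Qed.
End gaussian_tail.

(** * A single elimination run, with abstract estimates and radii *)

Section successive_elimination.
Context (R : realType) (K : nat).

(** Common form of [local_update] and [global_update]: [act] tells whether the round may eliminate,
    which is always so at a client and is [comm_step] at the server. *)
Definition elim_step (act : bool) (f : 'I_K -> R) (a : R)
    (p : {set 'I_K} * option 'I_K) : {set 'I_K} * option 'I_K :=
  if (1 < #|p.1|)%N && act then
    let S' := eliminate p.1 f a in
    if #|S'| == 1%N then (finset.set0, [pick k in S']) else (S', p.2)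
  else p.

Fixpoint elim_run (act : nat -> bool) (f : nat -> 'I_K -> R) (a : nat -> R)
    (N : nat) : {set 'I_K} * option 'I_K :=
  if N is N'.+1 then
    elim_step (act N) (f N) (a N) (elim_run act f a N')
  else (finset.setT, None).

Section correctness.
Variables (mu : 'I_K -> R) (b : 'I_K).
Hypothesis best : forall j, j != b -> mu j < mu b.

(** Invariant of a run. A pending set keeps at least two arms, because a set cut down to one arm is
    emptied within the same round. *)
Let valid (p : {set 'I_K} * option 'I_K) :=
  ((1 < #|p.1|)%N /\ b \in p.1) \/ p = (finset.set0, Some b).

(** For [j != b], accuracy gives [f j - f b <= mu j - mu b + 2 * a < 2 * a]; for [j = b], the
    difference is 0, below [2 * a] since [a] is positive. *)
Let mem_eliminate (S : {set 'I_K}) f a : 0 < a ->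
  (forall k, `|f k - mu k| <= a) -> b \in S -> b \in eliminate S f a.
Proof.
move=> a0 fa bS; rewrite inE bS /= negb_exists; apply/forallP => j.
rewrite negb_and -ltNge; apply/orP; right.
have [->|jb] := eqVneq j b; first by rewrite subrr mulr_gt0.
have := fa j; have := fa b; have := best jb; rewrite !ler_norml.
by move=> ? /andP[? ?] /andP[? ?]; lra.
Qed.

Let valid_single (S : {set 'I_K}) : b \in S -> #|S| = 1%N ->
  [pick k in S] = Some b.
Proof.
move=> bS /eqP/cards1P[k Sk]; move: bS; rewrite Sk inE => /eqP <-.
by case: pickP => [j|/(_ b)]; rewrite inE ?eqxx// => /eqP ->.
Qed.

Let valid_step act f a p : 0 < a -> (forall k, `|f k - mu k| <= a) ->
  valid p -> valid (elim_step act f a p).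
Proof.
move=> a0 fa [[p1 bp]|->]; last by right; rewrite /elim_step /= cards0.
rewrite /elim_step p1 /=; case: act; last by left.
have bS := mem_eliminate a0 fa bp.
case: ifPn => [/eqP S1|S1]; first by right; rewrite valid_single.
left; split => //=; rewrite ltn_neqAle eq_sym S1 /= card_gt0.
by apply/set0Pn; exists b.
Qed.

(** Estimation errors cost at most [2 * a] of a gap of [4 * a], so [b] itself removes every other
    arm in this one round. *)
Let final_step f a p : 0 < a -> (forall k, `|f k - mu k| <= a) ->
  (forall j, j != b -> 4 * a <= mu b - mu j) ->
  valid p -> elim_step true f a p = (finset.set0, Some b).
Proof.
move=> a0 fa gap [[p1 bp]|->]; last by rewrite /elim_step /= cards0.
rewrite /elim_step p1 /=.
have bS := mem_eliminate a0 fa bp.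
suff S1 : #|eliminate p.1 f a| = 1%N by rewrite S1 eqxx valid_single.
suff -> : eliminate p.1 f a = finset.set1 b by rewrite cards1.
apply/setP => k; rewrite [RHS]inE; have [->//|kb] := eqVneq k b.
rewrite inE; apply/negbTE; rewrite negb_and negbK; apply/orP; right.
apply/existsP; exists b; rewrite bp /=.
have := gap _ kb; have := fa k; have := fa b; rewrite !ler_norml.
by move=> /andP[? ?] /andP[? ?] ?; lra.
Qed.

(** Since there are finitely many arms, [4 * a n] is eventually below every gap to [b]. The next
    active round finishes the run, and a finished run no longer changes. *)
Lemma elim_run_correct (act : nat -> bool) (f : nat -> 'I_K -> R) (a : nat -> R) : (1 < K)%N ->
  (forall n, (0 < n)%N -> 0 < a n) ->
  (forall n k, (0 < n)%N -> `|f n k - mu k| <= a n) ->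
  a n @[n --> \oo] --> 0 ->
  (forall N, exists2 n, (N <= n)%N & act n) ->
  exists N0, forall N, (N0 <= N)%N ->
    elim_run act f a N = (finset.set0, Some b).
Proof.
move=> K1 a0 fa acvg actinf.
have vrun N : valid (elim_run act f a N).
  elim: N => [|N IH] /=; first by left; rewrite cardsT card_ord inE.
  by apply: valid_step => //; [exact: a0|move=> k; exact: fa].
have : \forall n \near \oo, forall j, j != b -> 4 * a n <= mu b - mu j.
  apply: filter_forall => j; have [_|jb] := eqVneq j b; first exact: nearW.
  have gap : 0 < (mu b - mu j) / 4 by rewrite divr_gt0// subr_gt0 best.
  have /cvgrPdist_lt/(_ _ gap) := acvg; apply: filterS => n /=.
  by rewrite sub0r normrN => /(le_lt_trans (ler_norm _)) ? _; lra.
(* Asking for a round beyond [N1.+1] also makes it positive: [elim_run] performs no round 0. *)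
move=> [N1 _ gapN1]; have [n N1n actn] := actinf N1.+1.
exists n; case: n N1n actn => // n N1n actn; elim=> // N IH.
rewrite leq_eqVlt => /orP[/eqP[<-]|nN]; last first.
  by rewrite /= IH// /elim_step /= cards0.
rewrite /= actn; apply: final_step; rewrite ?a0//.
  by move=> k; exact: fa.
by apply: gapN1 => /=; exact: ltnW.
Qed.
End correctness.

(** * Measurability of the state of a run *)

Section measurability.
Context (d : measure_display) (T : measurableType d).

(** Splitting on the finitely many values of [F] lets a random state be fed to a random update. *)
Lemma finite_measurable_bind (A B : finType) (F : T -> A) (G : A -> T -> B) :
  (forall a, measurable [set w | F w = a]) ->
  (forall a b, measurable [set w | G a w = b]) ->
  forall b, measurable [set w | G (F w) w = b].
Proof.
move=> mF mG b.
rewrite (_ : [set w | _] =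
    \bigcup_(a in [set: A]) ([set w | F w = a] `&` [set w | G a w = b])).
  by apply: fin_bigcup_measurable => // a _; exact: measurableI.
apply/seteqP; split=> [w /= <-|w [a _ [/= -> //]]].
by exists (F w).
Qed.

(** Membership of one arm is a finite Boolean combination of comparisons of estimates, and finitely
    many memberships determine the set. *)
Lemma measurable_eliminate (S : {set 'I_K}) (f : 'I_K -> T -> R) a S' :
  (forall k, measurable_fun setT (f k)) ->
  measurable [set w | eliminate S (f^~ w) a = S'].
Proof.
move=> mf.
have mE k : measurable [set w | k \in eliminate S (f^~ w) a].
  rewrite (_ : [set w | _] = [set w | k \in S] `&`
      ~` \bigcup_(j in [set` S]) [set w | 2 * a <= f j w - f k w]).
    apply: measurableI.
      by case: (k \in S); rewrite ?set_true ?set_false.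
    apply: measurableC; apply: fin_bigcup_measurable => [|j _]; first exact: finite_finset.
    rewrite -[X in measurable X]setTI.
    by apply: measurable_fun_le => //; exact: measurable_funB.
  apply/seteqP; split=> w /=; rewrite inE.
    move=> /andP[kS /existsPn h]; split=> // -[j /= jS jw].
    by have := h j; rewrite jS jw.
  move=> [-> /= h]; apply/existsPn => j; apply/negP => /andP[jS jw].
  by apply: h; exists j.
rewrite (_ : [set w | _] = \bigcap_(k in [set: 'I_K])
    [set w | (k \in eliminate S (f^~ w) a) = (k \in S')]).
  apply: fin_bigcap_measurable => // k _; case: (k \in S'); first exact: mE.
  rewrite (_ : [set w | _] = ~` [set w | k \in eliminate S (f^~ w) a]).
    exact: measurableC.
  by apply/seteqP; split=> w /= => [->|/negP/negbTE].
by apply/seteqP; split=> [w /= <- k _ //|w /= h]; apply/setP => k; exact: h.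
Qed.

Lemma measurable_elim_run (act : nat -> bool) (f : nat -> 'I_K -> T -> R) (a : nat -> R) N p :
  (forall n k, measurable_fun setT (f n k)) ->
  measurable [set w | elim_run act (fun n k => f n k w) a N = p].
Proof.
move=> mf; have mcst (A : finType) (c c' : A) : measurable [set w : T | c = c'].
  have [->|cc'] := eqVneq c c'; first by rewrite (_ : [set _ | _] = setT)// -subTset.
  by rewrite (_ : [set _ | _] = set0)// -subset0 => w /= /eqP; rewrite (negbTE cc').
elim: N p => [|N IH] p; first exact: mcst.
apply: (@finite_measurable_bind _ _ (fun w => elim_run act (fun n k => f n k w) a N)
  (fun p w => elim_step (act N.+1) (fun k => f N.+1 k w) (a N.+1) p)) => // -[S o] q.
rewrite /elim_step /=; case: (_ && _); last exact: mcst.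
(* Once the previous state is fixed, the new one depends on [w] only through the set that
   [eliminate] returns. *)
apply: (@finite_measurable_bind _ _ (fun w => eliminate S (fun k => f N.+1 k w) (a N.+1))
  (fun S' _ => if #|S'| == 1%N then (finset.set0, [pick k in S']) else (S', o))).
- by move=> S'; exact: measurable_eliminate.
- by move=> S' q'; exact: mcst.
Qed.
End measurability.
End successive_elimination.

(** * FedElim as a family of elimination runs *)

Section fedelim_runs.
Context (R : realType) (K M : nat) (delta : R) (x : 'I_K -> 'I_M -> nat -> R).

(** In [round], each candidate set and its output evolve from their own previous values only, so
    FedElim splits into [M] local runs and one global run. *)
Lemma local_elim_run m N :
  elim_run (fun=> true) (fun n k => muhat_loc x k m n) (alpha_l K M delta) N =
  (Sl (state_after delta x N) m, out_l (state_after delta x N) m).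
Proof.
elim: N => //= N ->; rewrite /elim_step /local_update /= andbT.
by do 2 case: ifP => //.
Qed.

Lemma global_elim_run N :
  elim_run comm_step (fun n k => muhat_glob x k n) (alpha_g K M delta) N =
  (Sg (state_after delta x N), out_g (state_after delta x N)).
Proof.
elim: N => //= N ->; rewrite /elim_step /global_update /=.
by do 2 case: ifP => //.
Qed.
End fedelim_runs.

Lemma comm_step_unbounded N : exists2 n, (N <= n)%N & comm_step n.
Proof.
exists (2 ^ N)%N; first exact/ltnW/ltn_expl.
(* [comm_step] quantifies over bounded exponents, hence the proof that [N] is within the bound. *)
by apply/existsP; exists (Ordinal (ltnW (ltn_expl N (ltnSn 1)) : (N < (2 ^ N).+1)%N)).
Qed.

(** * Positivity and decay of the confidence radii *)

Section confidence_radius.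
Context (R : realType).

(** Covers both [alpha_l] and [alpha_g]: [c] gathers the constants inside the logarithm, and [q]
    counts the clients averaged over (1 or [M]). *)
Definition radius (c q : R) (n : nat) : R :=
  Num.sqrt (2 * ln (c * n%:R ^+ 2) / (q * n%:R)).

Lemma alpha_lE (K M : nat) (delta : R) n :
  alpha_l K M delta n = radius (8 * K%:R * M%:R / delta) 1 n.
Proof. by rewrite /radius /alpha_l mul1r; congr (Num.sqrt (2 * ln _ / _)); ring. Qed.

Lemma alpha_gE (K M : nat) (delta : R) n :
  alpha_g K M delta n = radius (8 * K%:R / delta) M%:R n.
Proof. by congr (Num.sqrt (2 * ln _ / _)); ring. Qed.

Let radius_arg_ge (c : R) (n : nat) : 0 <= c -> (0 < n)%N -> c <= c * n%:R ^+ 2.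
Proof. by move=> c0 n0; rewrite ler_peMr// exprn_ege1// ler1n. Qed.

Lemma radius_gt0 (c q : R) (n : nat) : 1 < c -> 0 < q -> (0 < n)%N -> 0 < radius c q n.
Proof.
move=> c1 q0 n0; rewrite sqrtr_gt0 divr_gt0 ?mulr_gt0 ?ltr0n// ln_gt0//.
by apply: (lt_le_trans c1); apply: radius_arg_ge => //; lra.
Qed.

(** With [r] the square root of [n], [ln (c * r ^+ 4) <= c + 4 * r <= (c + 4) * r], so the squared
    radius is at most [2 * (c + 4) / r]. *)
Lemma radius_cvg0 (c q : R) : 1 <= c -> 1 <= q -> radius c q n @[n --> \oo] --> 0.
Proof.
move=> c1 q1; apply/cvgrPdist_lt => e e0.
pose C := 2 * (c + 4).
have e20 : 0 < e ^+ 2 by rewrite exprn_gt0.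
near=> n.
have n1 : (1 <= n%:R :> R) by near: n; exact: nbhs_infty_ger.
(* Equivalent to [C / r < e ^+ 2] for the square root [r] of [n]. *)
have nC : ((C / e ^+ 2) ^+ 2 < n%:R) by near: n; exact: nbhs_infty_gtr.
rewrite sub0r normrN ger0_norm ?sqrtr_ge0//.
rewrite -[ltRHS]ger0_norm ?(ltW e0)// -sqrtr_sqr ltr_sqrt//.
pose r : R := Num.sqrt n%:R.
have r2 : r ^+ 2 = n%:R by rewrite sqr_sqrtr.
have r1 : 1 <= r by rewrite -[leLHS]sqrtr1 ler_sqrt.
have r0 : 0 < r by lra.
have rC : C / e ^+ 2 < r.
  rewrite -ltr_sqr ?nnegrE ?(ltW r0)// ?r2//.
  by rewrite divr_ge0 ?(ltW e20)// /C; lra.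
have lnb : ln (c * n%:R ^+ 2) <= (c + 4) * r.
  rewrite -r2 -exprM lnM ?posrE ?exprn_gt0//; last by lra.
  rewrite lnXn// mulrDl lerD//.
    apply: (@le_trans _ _ c); first by apply/ltW/ln_sublinear; lra.
    by rewrite ler_peMr//; lra.
  by rewrite mulr_natl lerMn2r; apply/orP; right; exact/ltW/ln_sublinear.
apply: (@le_lt_trans _ _ (C / r)); last first.
  by rewrite ltr_pdivrMr// mulrC -ltr_pdivrMr.
rewrite ler_pdivrMr; last by rewrite mulr_gt0//; lra.
rewrite -[in X in q * X]r2 (_ : C / r * (q * r ^+ 2) = q * (C * r)); last first.
  by field; lra.
have : C * r <= q * (C * r) by rewrite ler_peMl// mulr_ge0 ?(ltW r0)// /C; lra.
by apply: le_trans; rewrite /C -mulrA ler_pM2l.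
Unshelve. all: end_near. Qed.
End confidence_radius.

(** * Finite and countable union bounds *)

Section union_bound.
Local Open Scope ereal_scope.
Context (d : measure_display) (T : measurableType d) (R : realType).
Context (P : {measure set T -> \bar R}).

Lemma measure_bigsetU_le_const (I : finType) (F : I -> set T) (c : R) :
  (forall i, measurable (F i)) -> (forall i, P (F i) <= c%:E) ->
  P (\big[setU/set0]_(i : I) F i) <= (c * #|I|%:R)%:E.
Proof.
move=> mF Fc.
apply: (@le_trans _ _ (\sum_(i : I) P (F i))).
  elim: (index_enum I) => [|i r IH]; first by rewrite !big_nil measure0.
  rewrite !big_cons; apply: (le_trans (measureU2 _ _ _)) => //.
    exact: bigsetU_measurable.
  exact: leeD2l.
apply: (@le_trans _ _ (\sum_(i : I) c%:E)); first exact: lee_sum.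
by rewrite sumEFin sumr_const mulr_natr.
Qed.

(** The subtracted term makes the induction telescope: [1 / x ^+ 2 <= 2 / x - 2 / (x + 1)] for
    [x >= 1]. *)
Lemma sum_inv_sqr_le (n : nat) :
  (\sum_(0 <= i < n) (i.+1%:R ^+ 2)^-1 <= 2 - 2 / n.+1%:R :> R)%R.
Proof.
elim: n => [|n IH]; first by rewrite big_nil divr1 subrr.
rewrite big_nat_recr//=; apply: (le_trans (lerD IH (lexx _))).
have n1 : (1 <= n.+1%:R :> R)%R by rewrite ler1n.
rewrite -(natr1 n.+1); move: (n.+1%:R : R) n1 => x x1.
rewrite -subr_ge0 (_ : (_ - _)%R = ((x - 1) / (x ^+ 2 * (x + 1)))%R).
  by rewrite divr_ge0 ?mulr_ge0 ?exprn_ge0//; lra.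
by field; lra.
Qed.

Lemma measure_bigcup_le_inv_sqr (F : nat -> set T) (c : R) : (0 <= c)%R ->
  (forall n, measurable (F n)) ->
  (forall n, P (F n) <= (c / n.+1%:R ^+ 2)%:E) ->
  P (\bigcup_n F n) <= (c * 2)%:E.
Proof.
move=> c0 mF Fc.
apply: (le_trans (measure_sigma_subadditive P mF _ (@subset_refl _ _))).
  exact: bigcup_measurable.
apply: lime_le; first by apply: is_cvg_nneseries => n _ _.
apply: nearW => n /=; apply: (@le_trans _ _ (\sum_(0 <= i < n) (c / i.+1%:R ^+ 2)%:E)).
  exact: lee_sum.
rewrite sumEFin lee_fin -mulr_sumr ler_wpM2l//.
apply: (le_trans (sum_inv_sqr_le n)).
by rewrite gerBl divr_ge0.
Qed.
End union_bound.

(** * Tail bounds for the local and global empirical means *)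

Section reward_tails.
Local Open Scope ereal_scope.
Context (R : realType) (K M : nat) (mu : 'I_K -> 'I_M -> R).
Context (d : measure_display) (T : measurableType d) (P : probability T R).
Variable X : 'I_K -> 'I_M -> nat -> T -> R.
Hypothesis indX : mutually_independent P (fun kmi : 'I_K * 'I_M * nat =>
  X kmi.1.1 kmi.1.2 kmi.2).
Hypothesis lawX : forall k m i, gaussian_unit_var P (mu k m) (X k m i).

Let x w k m i := X k m i w.
Let lawX' : forall kmi : 'I_K * 'I_M * nat,
  gaussian_unit_var P (mu kmi.1.1 kmi.1.2) (X kmi.1.1 kmi.1.2 kmi.2).
Proof. by move=> kmi; exact: lawX. Qed.

Lemma measurable_muhat_loc k m n :
  measurable_fun setT (fun w => muhat_loc (x w) k m n).
Proof.
apply: measurable_funM => //; apply: measurable_sum => i.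
by have [] := lawX k m i.
Qed.

Lemma measurable_muhat_glob k n :
  measurable_fun setT (fun w => muhat_glob (x w) k n).
Proof.
apply: measurable_funM => //; apply: measurable_sum => m.
exact: measurable_muhat_loc.
Qed.

(** [gaussian_mean_tail] for the first [n] rewards of one arm at one client, with [c * n%:R ^+ 2] as
    its constant. *)
Lemma muhat_loc_tail (c : R) k m n : (1 <= c)%R -> (0 < n)%N ->
  P [set w | (radius c 1 n <= `|muhat_loc (x w) k m n - mu k m|)%R] <=
  (2 / c / n%:R ^+ 2)%:E.
Proof.
move=> c1 n0; pose s := [seq (k, m, i) | i <- iota 0 n].
have sz : size s = n by rewrite size_map size_iota.
have n1 : (1 <= n%:R :> R)%R by rewrite ler1n.
have := @gaussian_mean_tail _ _ _ _ _ _ _ indX lawX' s (c * n%:R ^+ 2).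
rewrite sz map_inj_uniq ?iota_uniq; last by move=> i j [].
rewrite n0 mulr_ege1 ?exprn_ege1// => /(_ isT isT isT).
rewrite (_ : 2 / c / n%:R ^+ 2 = 2 / (c * n%:R ^+ 2))%R; last by rewrite -mulrA -invfM.
apply: le_trans; rewrite le_eqVlt; apply/orP; left.
apply/eqP; congr (P _); apply/funext => w /=; apply/propext.
have muE : (\sum_(i <- s) mu i.1.1 i.1.2 = mu k m * n%:R)%R.
  by rewrite big_map /= big_const_seq count_predT size_iota iter_addr_0 mulr_natr.
rewrite /radius mul1r muE mulfK; last by lra.
rewrite big_map /=.
by rewrite /muhat_loc -(big_mkord xpredT (fun i => x w k m i)) /index_iota subn0.
Qed.

(** All clients contribute [n] rewards each, so the average of the local means is the plain mean of
    [M * n] independent rewards; hence the factor [M] in the radius. *)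
Lemma muhat_glob_tail (c : R) k n : (0 < M)%N -> (1 <= c)%R -> (0 < n)%N ->
  P [set w | (radius c M%:R n <=
    `|muhat_glob (x w) k n - (\sum_(m < M) mu k m) / M%:R|)%R] <=
  (2 / c / n%:R ^+ 2)%:E.
Proof.
move=> M0 c1 n0.
pose s := [seq (k, m, i) | m <- index_enum 'I_M, i <- iota 0 n].
have sz : size s = (M * n)%N.
  by rewrite size_allpairs size_iota -sum1_size big_const_ord iter_addn_0 mul1n.
have n1 : (1 <= n%:R :> R)%R by rewrite ler1n.
have M1 : (1 <= M%:R :> R)%R by rewrite ler1n.
have us : uniq s.
  apply: allpairs_uniq; [exact: index_enum_uniq|exact: iota_uniq|].
  by move=> [? ?] [? ?] _ _ /= [-> ->].
have := @gaussian_mean_tail _ _ _ _ _ _ _ indX lawX' s (c * n%:R ^+ 2) us.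
rewrite sz muln_gt0 M0 n0 mulr_ege1 ?exprn_ege1// => /(_ isT isT).
rewrite (_ : 2 / c / n%:R ^+ 2 = 2 / (c * n%:R ^+ 2))%R; last by rewrite -mulrA -invfM.
apply: le_trans; rewrite le_eqVlt; apply/orP; left.
apply/eqP; congr (P _); apply/funext => w /=.
have sumE (F : 'I_K * 'I_M * nat -> R) :
    (\sum_(kmi <- s) F kmi = \sum_(m < M) \sum_(i < n) F (k, m, val i))%R.
  rewrite big_allpairs_dep; apply: eq_bigr => m _.
  by rewrite -(big_mkord xpredT (fun i => F (k, m, i))) /index_iota subn0.
rewrite /radius natrM !sumE /=; congr (is_true (_ <= `|_ - _|)%R).
  by rewrite /muhat_glob -mulr_suml; field; apply/andP; split; lra.
under [in RHS]eq_bigr do rewrite sumr_const card_ord -mulr_natr.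
by rewrite -mulr_suml; field; apply/andP; split; lra.
Qed.
End reward_tails.

(** * Correctness of FedElim on the accurate event, and its probability *)

Section fedelim_correctness.
Context (R : realType) (K M : nat) (delta : R) (mu : 'I_K -> 'I_M -> R).
Context (kl : 'I_M -> 'I_K) (kg : 'I_K).
Hypotheses (K1 : (1 < K)%N) (M1 : (1 < M)%N) (delta0 : 0 < delta) (delta1 : delta < 1).
Hypothesis best_l : forall (m : 'I_M) (j : 'I_K), j != kl m -> mu j m < mu (kl m) m.
Hypothesis best_g : forall j : 'I_K, j != kg ->
  (\sum_(m < M) mu j m) / M%:R < (\sum_(m < M) mu kg m) / M%:R.

Let cl : R := 8 * K%:R * M%:R / delta.
Let cg : R := 8 * K%:R / delta.

Let KR1 : 1 <= K%:R :> R. Proof. by rewrite ler1n ltnW. Qed.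
Let MR1 : 1 <= M%:R :> R. Proof. by rewrite ler1n ltnW. Qed.

Let cg1 : 1 < cg.
Proof. by rewrite /cg ltr_pdivlMr//; have := KR1; move: delta1; lra. Qed.

Let cl1 : 1 < cl.
Proof.
apply: (lt_le_trans cg1); rewrite /cl /cg ler_pM2r ?invr_gt0//.
by rewrite ler_peMr// mulr_ge0.
Qed.

Lemma fedelim_correct_of_accurate (x : 'I_K -> 'I_M -> nat -> R) :
  (forall n k m, (0 < n)%N -> `|muhat_loc x k m n - mu k m| <= alpha_l K M delta n) ->
  (forall n k, (0 < n)%N ->
    `|muhat_glob x k n - (\sum_(m < M) mu k m) / M%:R| <= alpha_g K M delta n) ->
  fedelim_correct delta x kl kg.
Proof.
move=> accl accg.
have /choice[Nl NlP] m : exists N0, forall N, (N0 <= N)%N ->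
    (Sl (state_after delta x N) m, out_l (state_after delta x N) m) =
    (finset.set0, Some (kl m)).
  have [||||N0 N0P] := @elim_run_correct _ _ (mu^~ m) (kl m) (best_l (m := m))
      (fun=> true) (fun n k => muhat_loc x k m n) (alpha_l K M delta) K1.
  - by move=> n n0; rewrite alpha_lE radius_gt0.
  - by move=> n k n0; exact: accl.
  - by under eq_fun do rewrite alpha_lE; apply: radius_cvg0 => //; exact: ltW.
  - by move=> N; exists N.
  - by exists N0 => N N0N; rewrite -local_elim_run N0P.
have [|||N0 N0P] := @elim_run_correct _ _ _ kg best_g comm_step
    (fun n k => muhat_glob x k n) (alpha_g K M delta) K1 _ _ _ comm_step_unbounded.
- by move=> n n0; rewrite alpha_gE radius_gt0// (lt_le_trans ltr01 MR1).
- by move=> n k n0; exact: accg.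
- by under eq_fun do rewrite alpha_gE; apply: radius_cvg0 => //; exact: ltW.
(* By time [N] all [M + 1] runs have finished, and none changes afterwards. *)
pose N := maxn N0 (\max_m Nl m).
have NlN m : (Nl m <= N)%N by rewrite leq_max orbC leq_bigmax.
have := N0P N (leq_maxl _ _); rewrite global_elim_run => -[Sg0 outg].
exists N; split; last by split=> // m; have [] := NlP m _ (NlN m).
by apply/forallP => m; have [-> _] := NlP m _ (NlN m); rewrite Sg0 finset.setU0.
Qed.

Context (d : measure_display) (T : measurableType d) (P : probability T R).
Variable X : 'I_K -> 'I_M -> nat -> T -> R.
Hypothesis indX : mutually_independent P (fun kmi : 'I_K * 'I_M * nat =>
  X kmi.1.1 kmi.1.2 kmi.2).
Hypothesis lawX : forall k m i, gaussian_unit_var P (mu k m) (X k m i).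

(** Success is a countable union over [N] of finite intersections of events about the states of the
    runs at time [N]. *)
Lemma measurable_fedelim_correct :
  measurable [set w | fedelim_correct delta (fun k m i => X k m i w) kl kg].
Proof.
pose st N w := state_after delta (fun k m i => X k m i w) N.
rewrite (_ : [set w | _] = \bigcup_N (
    \bigcap_(m in [set: 'I_M]) [set w | (Sl (st N w) m, out_l (st N w) m) =
                                       (finset.set0, Some (kl m))] `&`
    [set w | (Sg (st N w), out_g (st N w)) = (finset.set0, Some kg)])).
  apply: bigcup_measurable => N _; apply: measurableI.
    apply: fin_bigcap_measurable => [|m _]; first exact: finite_finset.
    rewrite /st; under eq_set do rewrite -local_elim_run.
    by apply: measurable_elim_run => n k; exact: measurable_muhat_loc lawX _ _ _.
  rewrite /st; under eq_set do rewrite -global_elim_run.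
  by apply: measurable_elim_run => n k; exact: measurable_muhat_glob lawX _ _.
apply/seteqP; split=> w /= [N].
  move=> [/forallP term [outl outg]]; exists N => //; split.
    move=> m _ /=; rewrite /st outl; congr (_, _); apply/eqP.
    by have := term m; rewrite finset.setU_eq0 => /andP[].
  rewrite /= /st outg; congr (_, _); apply/eqP.
  (* [terminated] mentions [Sg] only through a client; [M1] provides the client of index 1. *)
  by have := term (Ordinal M1); rewrite finset.setU_eq0 => /andP[].
move=> _ [hl [Sg0 outg]]; exists N; split; last first.
  by split=> // m; have [] := hl m I.
by apply/forallP => m; have [Sl0 _] := hl m I; rewrite -/(st N w) Sl0 Sg0 finset.setU0.
Qed.

Lemma fedelim_correct_prob :
  ((1 - delta)%:E <=
   P [set w | fedelim_correct delta (fun k m i => X k m i w) kl kg])%E.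
Proof.
pose x w k m i := X k m i w.
pose bad_l n (km : 'I_K * 'I_M) :=
  [set w | radius cl 1 n <= `|muhat_loc (x w) km.1 km.2 n - mu km.1 km.2|].
pose bad_g n k := [set w | radius cg M%:R n <=
  `|muhat_glob (x w) k n - (\sum_(m < M) mu k m) / M%:R|].
(* Shifted by one, since rounds are numbered from 1. *)
pose bad n := \big[setU/set0]_km bad_l n.+1 km `|` \big[setU/set0]_k bad_g n.+1 k.
have mbad_l n km : measurable (bad_l n km).
  rewrite -[X in measurable X]setTI; apply: measurable_fun_le => //.
  apply: measurableT_comp => //; apply: measurable_funB => //.
  exact: measurable_muhat_loc lawX _ _ _.
have mbad_g n k : measurable (bad_g n k).
  rewrite -[X in measurable X]setTI; apply: measurable_fun_le => //.
  apply: measurableT_comp => //; apply: measurable_funB => //.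
  exact: measurable_muhat_glob lawX _ _.
have mbad n : measurable (bad n).
  by apply: measurableU; apply: bigsetU_measurable.
have Pbad n : (P (bad n) <= (delta / 2 / n.+1%:R ^+ 2)%:E)%E.
  apply: (le_trans (measureU2 _ _ _)); [exact: bigsetU_measurable..|].
  have hl := measure_bigsetU_le_const (mbad_l n.+1)
    (fun km => muhat_loc_tail indX lawX km.1 km.2 (ltW cl1) (ltn0Sn n)).
  have hg := measure_bigsetU_le_const (mbad_g n.+1)
    (fun k => muhat_glob_tail indX lawX k (ltnW M1) (ltW cg1) (ltn0Sn n)).
  (* The [K * M] local events, each of probability at most [2 / cl / n.+1%:R ^+ 2], and the [K]
     global ones with [cg] contribute [delta / 4 / n.+1%:R ^+ 2] each way. *)
  apply: (le_trans (leeD hl hg)); rewrite -EFinD lee_fin le_eqVlt; apply/orP; left.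
  rewrite card_prod !card_ord natrM /cl /cg; apply/eqP; field.
  by rewrite !gt_eqF ?ltr0n//; exact: ltnW.
have mB : measurable (\bigcup_n bad n) by exact: bigcup_measurable.
have PB : (P (\bigcup_n bad n) <= delta%:E)%E.
  have := measure_bigcup_le_inv_sqr _ mbad Pbad.
  by rewrite divfK//; apply; rewrite divr_ge0// ltW.
apply: (@le_trans _ _ (P (~` \bigcup_n bad n))).
  rewrite probability_setC// EFinB leeB//.
apply: le_measure; rewrite ?inE//.
- exact: measurableC.
- exact: measurable_fedelim_correct.
- move=> w /= nbad; apply: fedelim_correct_of_accurate => [[//|n] k m|[//|n] k] _.
  + rewrite alpha_lE leNgt; apply/negP => /ltW h; apply: nbad; exists n => //.
    by left; rewrite (bigD1 (k, m))//=; left.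
  + rewrite alpha_gE leNgt; apply/negP => /ltW h; apply: nbad; exists n => //.
    by right; rewrite (bigD1 k)//=; left.
Qed.
End fedelim_correctness.

Theorem theorem1 (R : realType) (K M : nat) (C delta : R)
  (HK : (1 < K)%N) (HM : (1 < M)%N) (HC : 0 <= C)
  (Hdelta0 : 0 < delta) (Hdelta1 : delta < 1)
  (mu : 'I_K -> 'I_M -> R)
  (kl : 'I_M -> 'I_K) (kg : 'I_K)
  (Hkl : forall (m : 'I_M) (j : 'I_K), j != kl m -> mu j m < mu (kl m) m)
  (Hkg : forall j : 'I_K, j != kg ->
     (\sum_(m < M) mu j m) / M%:R < (\sum_(m < M) mu kg m) / M%:R)
  (d : measure_display) (T : measurableType d) (P : probability T R)
  (X : 'I_K -> 'I_M -> nat -> T -> R)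
  (Hind : mutually_independent P (fun kmi : 'I_K * 'I_M * nat =>
            X kmi.1.1 kmi.1.2 kmi.2))
  (Hlaw : forall k m i, gaussian_unit_var P (mu k m) (X k m i)) :
  (P [set w | fedelim_correct delta (fun k m i => X k m i w) kl kg]
     >= (1 - delta)%:E)%E.
Proof. exact: (fedelim_correct_prob HK HM Hdelta0 Hdelta1 Hkl Hkg Hind Hlaw). Qed.
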